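(* Let $0<\mu<\beta$ and $\sigma_{\max}=\sqrt{\mu(\beta-\mu)}$. For $\sigma\in(0,\sigma_{\max})$ and $p\in(0,\beta]$ let $\hat R(p)=\inf_{\mathbb{P}\in\mathcal{P}(\mu,\sigma,\beta)}p\,\mathbb{P}(X\ge p)$. Then the equation $R_1(p^*_l(\sigma))=R_3(p^*_h(\sigma,\beta))$ has a unique solution $\sigma=\sigma^*\in(0,\sigma_{\max})$, and the optimal robust price $\hat p^*=\arg\sup_p\hat R(p)$ is $$\hat p^*=\begin{cases}p^*_l(\sigma)&\text{if }\sigma\le\sigma^*,\\ p^*_h(\sigma,\beta)&\text{if }\sigma\ge\sigma^*,\end{cases}$$ i.e. the supremum of $\hat R$ over $(0,\beta]$ is attained at the indicated price (at both prices if $\sigma=\sigma^*$).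
   Context: $\mathcal{P}(\mu,\sigma,\beta)$ is the set of all Borel probability distributions $\mathbb{P}$ of a random variable $X$ with $\mathbb{P}(X\in[0,\beta])=1$, mean $\mu$ and standard deviation exactly $\sigma$. $R_1(p)=\frac{p(\mu-p)^2}{(\mu-p)^2+\sigma^2}$ and $R_3(p)=\frac{p(\mu(\mu-p)+\sigma^2)}{\beta(\beta-p)}$ (both depend on $\sigma$). $p^*_h(\sigma,\beta)=\beta-\sqrt{\beta\left(\beta-\mu-\sigma^2/\mu\right)}$ and $p^*_l(\sigma)=\mu-\sigma\,\kappa(\mu,\sigma)$, where (with real cube roots) $$\kappa(\mu,\sigma)=\left(\tfrac{\mu}{\sigma}+\sqrt{1+(\tfrac{\mu}{\sigma})^2}\right)^{1/3}+\left(\tfrac{\mu}{\sigma}-\sqrt{1+(\tfrac{\mu}{\sigma})^2}\right)^{1/3}.$$ *)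

(* Defs.v *)
From HB Require Import structures.
From mathcomp Require Import all_boot all_order all_algebra.
From mathcomp Require Import all_classical all_reals all_analysis.

Set Implicit Arguments.
Unset Strict Implicit.
Unset Printing Implicit Defensive.

Import Order.TTheory GRing.Theory Num.Theory.
Import numFieldNormedType.Exports.

Local Open Scope classical_set_scope.
Local Open Scope ring_scope.

Section robust_pricing.
Context {R : realType}.
Implicit Types mu sigma beta p x : R.

(* A Borel law P is identified with the law of X = id on (R, Borel, P). *)
Definition ambiguity_set mu sigma beta :=
  [set P : probability (measurableTypeR R) R | [/\ P [set x : R | 0 <= x <= beta] = 1%E,
               ('E_P[fun x : measurableTypeR R => x : R] = mu%:E)%E
             & sqrte ('V_P[fun x : measurableTypeR R => x : R])%E = sigma%:E]].

(* Valued in \bar R, so that no convention is needed for the infimum of an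
   empty or unbounded set of reals. *)
Definition robust_revenue mu sigma beta p : \bar R :=
  ereal_inf [set (p%:E * P [set x : R | (p <= x)%R])%E | P in ambiguity_set mu sigma beta].

Definition argsup (D : set R) (f : R -> \bar R) : set R :=
  [set p | D p /\ f p = ereal_sup [set f q | q in D]].

Definition sigma_max mu beta : R := Num.sqrt (mu * (beta - mu)).

Definition R1 mu sigma p : R :=
  p * (mu - p) ^+ 2 / ((mu - p) ^+ 2 + sigma ^+ 2).

Definition R3 mu sigma beta p : R :=
  p * (mu * (mu - p) + sigma ^+ 2) / (beta * (beta - p)).

(* The sign is factored out because powR is not the real root at negative
   arguments. *)
Definition cbrt x : R := Num.sg x * `|x| `^ (3%:R^-1).

Lemma cbrtK x : cbrt x ^+ 3 = x.
Proof.
rewrite /cbrt exprMn -(powR_mulrn 3 (powR_ge0 _ _)) -powRrM.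
rewrite mulVf ?pnatr_eq0// powRr1// [RHS]numEsg; congr (_ * _).
by case: sgrP => _; rewrite ?expr0n ?expr1n// exprS sqrrN expr1n mulr1.
Qed.

Definition kappa mu sigma : R :=
  cbrt (mu / sigma + Num.sqrt (1 + (mu / sigma) ^+ 2)) +
  cbrt (mu / sigma - Num.sqrt (1 + (mu / sigma) ^+ 2)).

Definition p_low mu sigma : R := mu - sigma * kappa mu sigma.

Definition p_high mu sigma beta : R :=
  beta - Num.sqrt (beta * (beta - mu - sigma ^+ 2 / mu)).

End robust_pricing.

(* Main.v *)
(** Put [d = mu - p_low = sigma * kappa] and [s = beta - p_high].  By Cardano,
    [d^3 = sigma^2 (2 mu - 3 d)], and then [R1 p_low = mu - 3/2 d] exceeds
    [R1 p] by a multiple of [(mu - p - d)^2]; similarly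
    [R3 p_high = mu (1 - s / beta)^2] exceeds [R3 p] by a multiple of
    [(beta - p - s)^2].  So both prices are global maximisers.

    Integrating a parabola lying below the indicator of [p, +oo[ gives
    [R1, R3 <= robust_revenue].  Conversely, for every [q < p] a law on at most
    three points, with all atoms but the last at most [q], puts at most the mass
    [max(R1 q, R3 q, 0) / q] on [p, +oo[; letting [q] tend to [p] bounds
    the robust revenue by the larger of the two maxima.

    [R1 p_low] strictly decreases and [R3 p_high] strictly increases with
    [sigma], since this holds pointwise in the price, and they cross by the
    intermediate value theorem. *)

From HB Require Import structures.
Require Import Defs.
From mathcomp Require Import all_boot all_order all_algebra.
From mathcomp Require Import all_classical all_reals all_analysis.
From mathcomp Require Import measurable_realfun ring lra.
Import Order.TTheory GRing.Theory Num.Theory.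
Import numFieldNormedType.Exports.
Set Implicit Arguments.
Unset Strict Implicit.
Unset Printing Implicit Defensive.
Local Open Scope classical_set_scope.
Local Open Scope ring_scope.

(** * Laws with at most three atoms *)

Section three_point_law.
Context d (T : measurableType d) (R : realType).

Section combination.
Variables (w1 w2 w3 : {nonneg R}) (a1 a2 a3 : T).

Definition dirac3 : set T -> \bar R :=
  measure_add (measure_add (mscale w1 \d_a1) (mscale w2 \d_a2))
              (mscale w3 \d_a3).

HB.instance Definition _ := Measure.on dirac3.

Lemma dirac3E A : dirac3 A =
  (w1%:num * (a1 \in A)%:R + w2%:num * (a2 \in A)%:R
   + w3%:num * (a3 \in A)%:R)%:E.
Proof. by rewrite /dirac3 measure_addE [X in (X + _)%E]measure_addE. Qed.

Lemma ge0_integral_dirac3 (f : T -> R) :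
  measurable_fun setT f -> (forall x, 0 <= f x) ->
  (\int[dirac3]_x (f x)%:E
   = (w1%:num * f a1 + w2%:num * f a2 + w3%:num * f a3)%:E)%E.
Proof.
move=> mf f_ge0; have mF : measurable_fun setT (EFin \o f).
  exact/measurable_EFinP.
have F_ge0 x : setT x -> (0 <= (EFin \o f) x)%E by rewrite lee_fin.
rewrite [LHS]ge0_integral_measure_add//.
rewrite [X in (X + _)%E]ge0_integral_measure_add//.
by rewrite !ge0_integral_mscale// !integral_dirac//= !diracT !mul1e.
Qed.

Lemma integral_dirac3 (f : T -> R) : measurable_fun setT f ->
  (\int[dirac3]_x (f x)%:E
   = (w1%:num * f a1 + w2%:num * f a2 + w3%:num * f a3)%:E)%E.
Proof.
move=> mf; rewrite -[X in integral _ _ X]/(EFin \o f).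
rewrite integralE funerpos funerneg.
have mfp := measurable_funrpos mf; have mfn := measurable_funrneg mf.
rewrite !ge0_integral_dirac3//.
have fE x : f x = f^\+ x - f^\- x by rewrite -[in LHS](funrposBneg f).
by rewrite -EFinB !fE; congr EFin; ring.
Qed.

End combination.

Lemma three_point_law (w1 w2 w3 : R) (a1 a2 a3 : T) :
    0 <= w1 -> 0 <= w2 -> 0 <= w3 -> w1 + w2 + w3 = 1 ->
  exists P : probability T R,
    (forall A, P A = (w1 * (a1 \in A)%:R + w2 * (a2 \in A)%:R
                      + w3 * (a3 \in A)%:R)%:E) /\
    (forall f : T -> R, measurable_fun setT f ->
      (\int[P]_x (f x)%:E = (w1 * f a1 + w2 * f a2 + w3 * f a3)%:E)%E).
Proof.
move=> w1_ge0 w2_ge0 w3_ge0 w_sum.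
pose m := dirac3 (NngNum w1_ge0) (NngNum w2_ge0) (NngNum w3_ge0) a1 a2 a3.
have m1 : m setT = 1%E by rewrite /m dirac3E/= !in_setT !mulr1 w_sum.
pose P : probability T R := HB.pack m (Measure_isProbability.Build _ _ _ m m1).
by exists P; split=> [A|f mf]; [exact: dirac3E|exact: integral_dirac3].
Qed.

End three_point_law.

(** * Moment bounds on the tail, from below for every law and from above by a single law *)

Section ambiguity_set.
Context {R : realType}.
Implicit Types mu sigma beta p c : R.
Local Notation T := (measurableTypeR R).

(** The complement of the interval is negligible, so boundedness of [f] matters only on the
    interval; polynomials thereby become integrable. *)
Lemma integrable_bounded_support (P : probability T R) (a b : R) (f : R -> R) :
    P `[a, b]%classic = 1%E -> measurable_fun setT f ->
    [bounded f x | x in `[a, b]] ->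
  P.-integrable setT (EFin \o f).
Proof.
move=> Pab mf f_bnd; have mab : measurable (~` `[a, b]%classic : set T).
  exact: measurableC.
have PabC : P (~` `[a, b]%classic) = 0%E.
  by rewrite probability_setC// Pab subee.
apply: (iffRL (@negligible_integrable _ T R P setT _ _ mab _ _ PabC)) => //.
  exact/measurable_EFinP.
rewrite setTD setCK; apply: measurable_bounded_integrable => //.
  by rewrite -[X in (X < _)%E]/(P `[a, b]%classic) Pab ltry.
exact: measurable_funTS.
Qed.

Lemma ambiguity_set_integral_sqr mu sigma beta (P : probability T R) :
  ambiguity_set mu sigma beta P ->
  (\int[P]_x ((x - mu) ^+ 2)%:E = (sigma ^+ 2)%:E)%E.
Proof.
move=> [_ mean_mu var_sigma].
have := sqr_sqrte (variance_ge0 P (fun x : T => x : R)).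
rewrite var_sigma EFin_expe => ->.
rewrite /variance covariance.unlock mean_mu expectation.unlock /=.
by apply: eq_integral => x _; rewrite expr2.
Qed.

(** Weak duality. In the basis [1], [x], [(x - mu) ^+ 2] the expectation of the parabola is read off
    from the moments, the same for every law of the set. Since the law lives on [[0, beta]], the
    parabola need only stay below the indicator there. *)
Lemma ambiguity_set_tail mu sigma beta p (c0 c1 c2 : R) (P : probability T R) :
    ambiguity_set mu sigma beta P ->
    (forall x, 0 <= x <= beta ->
       c0 + c1 * x + c2 * (x - mu) ^+ 2 <= ((p <= x)%R)%:R) ->
  ((c0 + c1 * mu + c2 * sigma ^+ 2)%:E <= P [set x : R | (p <= x)%R])%E.
Proof.
move=> ambP q_le; have intV := ambiguity_set_integral_sqr ambP.
case: ambP => P_supp mean_mu _.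
have PD : P `[0, beta]%classic = 1%E by rewrite -P_supp set_itvcc.
have cts_int (f : R -> R) : continuous f -> P.-integrable setT (EFin \o f).
  move=> cf; apply: (integrable_bounded_support PD).
    exact: continuous_measurable_fun.
  have := compact_bounded (continuous_compact (continuous_subspaceT cf)
    (@segment_compact R 0 beta)).
  move=> [r [r_real fr]]; exists r; split=> // M rM x Dx.
  by apply: (fr M rM); exists x.
have int1 : P.-integrable setT (EFin \o (fun x : T => x : R)).
  by apply: cts_int => x; exact: cvg_id.
have int2 : P.-integrable setT (EFin \o (fun x : T => (x - mu) ^+ 2)).
  apply: cts_int => x.
  have cB : {for x, continuous (fun y : R => y - mu)}.
    by apply: cvgB; [exact: cvg_id|exact: cvg_cst].
  exact: (continuous_comp cB (@exprn_continuous _ 2 _)).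
have intc : P.-integrable setT (EFin \o cst c0).
  exact: finite_measure_integrable_cst.
have int12 := integrableD measurableT (integrableZl measurableT c1 int1)
  (integrableZl measurableT c2 int2).
have int_q := integrableD measurableT intc int12.
have q_int :
  (\int[P]_x (c0%:E + (c1%:E * x%:E + c2%:E * ((x - mu) ^+ 2)%:E))
    = (c0 + c1 * mu + c2 * sigma ^+ 2)%:E)%E.
  rewrite integralD// integralD//; last 2 first.
  - exact: integrableZl.
  - exact: integrableZl.
  rewrite [X in (_ + (X + _))%E](integralZl measurableT int1 c1).
  rewrite [X in (_ + (_ + X))%E](integralZl measurableT int2 c2) intV.
  have := expectation_cst P c0; move: mean_mu; rewrite expectation.unlock.
  by move=> -> /= ->; rewrite -!EFinM -!EFinD addrA.
rewrite -q_int.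
have mA : measurable ([set x | p <= x] : set T).
  by rewrite -set_itvcy; exact: measurable_itv.
rewrite -[X in (_ <= P X)%E]setIT -integral_indic//.
(* Discard the null complement of [[0, beta]] from both integrals, then compare pointwise. *)
have mN : measurable (~` `[0, beta]%classic : set T) by exact: measurableC.
have PN : P (~` `[0, beta]%classic) = 0%E.
  by rewrite probability_setC// PD subee.
have int_ind := integrable_indic P mA.
rewrite (negligible_integral mN _ int_q PN)//.
rewrite (negligible_integral mN _ int_ind PN)// setTD setCK.
apply: le_integral => //.
- exact: integrableS int_q.
- exact: integrableS int_ind.
move=> x; rewrite inE/= in_itv/= => xD.
rewrite -!EFinM -!EFinD lee_fin indicE mem_setE.
by have := q_le x xD; rewrite addrA.
Qed.

Lemma robust_revenue_le mu sigma beta p w1 w2 w3 a1 a2 a3 :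
    0 <= sigma -> 0 <= p ->
    0 <= w1 -> 0 <= w2 -> 0 <= w3 -> w1 + w2 + w3 = 1 ->
    0 <= a1 <= beta -> 0 <= a2 <= beta -> 0 <= a3 <= beta ->
    w1 * a1 + w2 * a2 + w3 * a3 = mu ->
    w1 * (a1 - mu) ^+ 2 + w2 * (a2 - mu) ^+ 2 + w3 * (a3 - mu) ^+ 2
      = sigma ^+ 2 ->
    a1 < p -> a2 < p ->
  (robust_revenue mu sigma beta p <= (p * w3)%:E)%E.
Proof.
move=> sigma_ge0 p_ge0 w1_ge0 w2_ge0 w3_ge0 w_sum a1D a2D a3D mean_mu var_sigma.
move=> a1p a2p.
have [P [PA Pint]] :=
  @three_point_law _ T R w1 w2 w3 a1 a2 a3 w1_ge0 w2_ge0 w3_ge0 w_sum.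
have mean : ('E_P[fun x : T => x : R] = mu%:E)%E.
  rewrite expectation.unlock -mean_mu; exact: (Pint id).
apply: (@le_trans _ _ (p%:E * P [set x : R | (p <= x)%R])%E).
  apply: ereal_inf_lbound; exists P => //; split => //.
  - by rewrite PA !mem_set ?mulr1 ?w_sum//=.
  - rewrite /variance covariance.unlock mean expectation.unlock /=.
    rewrite (Pint (fun x => (x - mu) * (x - mu))) /=; last first.
      by apply: measurable_funM; apply: measurable_funB.
    by rewrite -!expr2 var_sigma sqrtr_sqr ger0_norm.
rewrite PA /= -EFinM lee_fin ler_wpM2l//.
have [a1N a2N] : (a1 \in [set x : R | p <= x]) = false
    /\ (a2 \in [set x : R | p <= x]) = false.
  by split; apply/negP; rewrite inE/= leNgt ?a1p ?a2p.
rewrite a1N a2N !mulr0 !add0r.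
by rewrite ler_piMr// lern1 leq_b1.
Qed.

End ambiguity_set.

(** * Values, maximality and monotonicity in [sigma] of [R1] at [p_low] and [R3] at [p_high] *)

Section price_formulas.
Context {R : realType}.
Implicit Types mu sigma beta p d s x : R.

Lemma cube_inj x y : x ^+ 3 = y ^+ 3 -> x = y.
Proof.
move=> e; apply/eqP; rewrite -subr_eq0; apply/eqP.
have : (x - y) * (x ^+ 2 + x * y + y ^+ 2) = 0 by ring: e.
move/eqP; rewrite mulf_eq0 => /orP[/eqP //|/eqP e2].
have h : (x + y / 2) ^+ 2 + 3 / 4 * y ^+ 2 = 0 by rewrite -e2; field.
have y0 : y ^+ 2 = 0 by have := sqr_ge0 (x + y / 2); have := sqr_ge0 y; lra.
move/eqP : y0; rewrite sqrf_eq0 => /eqP y0; rewrite y0 in e *.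
move/eqP : e; rewrite expr0n/= expf_eq0 => /eqP ->; lra.
Qed.

(* Cardano's formula. *)
Lemma kappa_cubic mu sigma :
  kappa mu sigma ^+ 3 + 3 * kappa mu sigma = 2 * (mu / sigma).
Proof.
rewrite /kappa; set r := mu / sigma; set q := Num.sqrt _.
have q2 : q ^+ 2 = 1 + r ^+ 2 by rewrite sqr_sqrtr// addr_ge0 ?sqr_ge0.
have := cbrtK (r + q); have := cbrtK (r - q).
set u := cbrt (r + q); set v := cbrt (r - q) => v3 u3.
(* The cube of [u * v] is [r ^+ 2 - q ^+ 2 = -1], and real cube roots are unique. *)
have uv : u * v = -1 by apply: cube_inj; rewrite exprMn u3 v3; ring: q2.
have -> : (u + v) ^+ 3 + 3 * (u + v)
  = u ^+ 3 + v ^+ 3 + 3 * (u * v + 1) * (u + v) by ring.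
by rewrite u3 v3 uv; ring.
Qed.


Lemma kappa_gap mu sigma (d := sigma * kappa mu sigma) : 0 < mu -> 0 < sigma ->
  [/\ d ^+ 3 = sigma ^+ 2 * (2 * mu - 3 * d), 0 < d & 3 * d < 2 * mu].
Proof.
move=> mu0 s0; have k3 := kappa_cubic mu sigma; rewrite /d.
set k := kappa mu sigma in k3 *.
have ms0 : 0 < mu / sigma by rewrite divr_gt0.
have d3 : (sigma * k) ^+ 3 = sigma ^+ 2 * (2 * mu - 3 * (sigma * k)).
  have -> : (sigma * k) ^+ 3
    = sigma ^+ 3 * (k ^+ 3 + 3 * k) - 3 * sigma ^+ 3 * k by ring.
  by rewrite k3; field; rewrite gt_eqF.
have k0 : 0 < k.
  rewrite ltNge; apply/negP => k_le0.
  have : k ^+ 3 <= 0 by rewrite exprS mulr_le0_ge0// sqr_ge0.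
  by lra.
have d0 : 0 < sigma * k by rewrite mulr_gt0.
(* The last bound holds because [sigma ^+ 2 * (2 * mu - 3 * d)] equals the positive number
   [d ^+ 3]. *)
split=> //; rewrite -subr_gt0 -(@pmulr_rgt0 _ (sigma ^+ 2)) ?exprn_gt0//.
by rewrite -d3 exprn_gt0.
Qed.

(** The map sending [d] to [d ^+ 3 + 3 * sigma ^+ 2 * d] is injective: in the factored difference of
    two values, the cofactor of [e - d] is a sum of squares plus [3 * sigma ^+ 2]. *)
Lemma kappa_gap_uniq mu sigma d : 0 < mu -> 0 < sigma ->
  d ^+ 3 = sigma ^+ 2 * (2 * mu - 3 * d) -> sigma * kappa mu sigma = d.
Proof.
move=> mu0 s0 d3; have [e3 _ _] := kappa_gap mu0 s0.
set e := sigma * kappa mu sigma in e3 *.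
have s2 : 0 < sigma ^+ 2 by rewrite exprn_gt0.
have : (e - d) * ((e + d / 2) ^+ 2 + 3 / 4 * d ^+ 2 + 3 * sigma ^+ 2) = 0.
  have -> : (e - d) * ((e + d / 2) ^+ 2 + 3 / 4 * d ^+ 2 + 3 * sigma ^+ 2)
    = e ^+ 3 - d ^+ 3 + 3 * sigma ^+ 2 * (e - d) by field.
  by rewrite e3 d3; ring.
move/eqP; rewrite mulf_eq0 => /orP[|/eqP h].
  by rewrite subr_eq0 => /eqP.
by have := sqr_ge0 (e + d / 2); have := sqr_ge0 d; lra.
Qed.

Lemma R1_p_low mu sigma : 0 < mu -> 0 < sigma ->
  R1 mu sigma (p_low mu sigma) = mu - 3 / 2 * (sigma * kappa mu sigma).
Proof.
move=> mu0 s0; have [d3 d0 d_lt] := kappa_gap mu0 s0; rewrite /R1 /p_low.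
set d := sigma * kappa mu sigma in d3 d0 d_lt *.
have s2 : 0 < sigma ^+ 2 by rewrite exprn_gt0.
rewrite opprB addrCA subrr addr0.
have dd : 0 < d ^+ 2 by rewrite exprn_gt0.
apply: (@mulIf _ (d ^+ 2 + sigma ^+ 2)); first by rewrite gt_eqF// addr_gt0.
rewrite divfK; last by rewrite gt_eqF// addr_gt0.
have -> : (mu - 3 / 2 * d) * (d ^+ 2 + sigma ^+ 2)
  = (mu - 3 / 2 * d) * d ^+ 2 + sigma ^+ 2 * (2 * mu - 3 * d) / 2 by field.
by rewrite -d3; field.
Qed.

Lemma R1_max mu sigma p : 0 < mu -> 0 < sigma -> p < mu ->
  R1 mu sigma p <= R1 mu sigma (p_low mu sigma).
Proof.
move=> mu0 s0 pmu; have [d3 d0 d_lt] := kappa_gap mu0 s0.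
rewrite R1_p_low//; set d := sigma * kappa mu sigma in d3 d0 d_lt *.
have s2 : 0 < sigma ^+ 2 by rewrite exprn_gt0.
rewrite /R1 ler_pdivrMr; last by rewrite ltr_wpDl ?sqr_ge0.
rewrite -subr_ge0.
have -> : (mu - 3 / 2 * d) * ((mu - p) ^+ 2 + sigma ^+ 2) - p * (mu - p) ^+ 2
  = (mu - p) ^+ 3 - 3 / 2 * d * (mu - p) ^+ 2
    + sigma ^+ 2 * (2 * mu - 3 * d) / 2 by field.
(* The cubic equation turns the constant term into [d ^+ 3 / 2], so that the cubic in [mu - p] has a
   double root at [d]; its other root [- d / 2] is out of reach since [p < mu]. *)
rewrite -d3.
have -> : (mu - p) ^+ 3 - 3 / 2 * d * (mu - p) ^+ 2 + d ^+ 3 / 2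
  = (mu - p - d) ^+ 2 * (mu - p + d / 2) by field.
by rewrite mulr_ge0 ?sqr_ge0//; lra.
Qed.

Lemma sigma_max_sqr mu sigma beta : 0 < mu -> mu < beta ->
  0 < sigma < sigma_max mu beta -> sigma ^+ 2 < mu * (beta - mu).
Proof.
move=> mu0 mub /andP[s0]; rewrite /sigma_max => sm.
have mb : 0 <= mu * (beta - mu) by rewrite mulr_ge0// ?subr_ge0 ltW.
by rewrite -(sqr_sqrtr mb) ltr_pXn2r ?nnegrE ?sqrtr_ge0// ltW.
Qed.

Lemma p_high_gap mu sigma beta
    (s := Num.sqrt (beta * (beta - mu - sigma ^+ 2 / mu))) :
    0 < mu -> mu < beta -> sigma ^+ 2 < mu * (beta - mu) ->
  [/\ mu * s ^+ 2 = beta * (mu * (beta - mu) - sigma ^+ 2), 0 < s & s < beta].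
Proof.
move=> mu0 mub s_lt; have b0 : 0 < beta by lra.
have r0 : 0 < beta - mu - sigma ^+ 2 / mu.
  by rewrite subr_gt0 ltr_pdivrMr// mulrC.
have sm : 0 <= sigma ^+ 2 / mu by rewrite divr_ge0 ?sqr_ge0// ltW.
have s0 : 0 < s by rewrite /s sqrtr_gt0 mulr_gt0.
have s2 : s ^+ 2 = beta * (beta - mu - sigma ^+ 2 / mu).
  by rewrite sqr_sqrtr// mulr_ge0// ltW.
split=> //; first by rewrite s2; field; rewrite gt_eqF.
rewrite -(@ltr_pXn2r _ 2) ?nnegrE ?(ltW s0) ?(ltW b0)// s2 expr2 ltr_pM2l//.
by lra.
Qed.

Lemma R3_p_high mu sigma beta : 0 < mu -> mu < beta ->
    sigma ^+ 2 < mu * (beta - mu) ->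
  R3 mu sigma beta (p_high mu sigma beta)
  = mu * (p_high mu sigma beta / beta) ^+ 2.
Proof.
move=> mu0 mub s_lt; have [s2 s0 sb] := p_high_gap mu0 mub s_lt.
rewrite /R3 /p_high; set s := Num.sqrt _ in s2 s0 sb *.
have b0 : 0 < beta by lra.
have s2E : sigma ^+ 2 = mu * (beta - mu) - mu * s ^+ 2 / beta.
  by rewrite s2; field; rewrite gt_eqF.
by rewrite s2E; field; rewrite opprB addrCA subrr addr0 !gt_eqF.
Qed.

Lemma R3_max mu sigma beta p : 0 < mu -> mu < beta ->
    sigma ^+ 2 < mu * (beta - mu) -> p < beta ->
  R3 mu sigma beta p <= R3 mu sigma beta (p_high mu sigma beta).
Proof.
move=> mu0 mub s_lt pb; have [s2 s0 sb] := p_high_gap mu0 mub s_lt.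
rewrite R3_p_high// /R3 /p_high; set s := Num.sqrt _ in s2 s0 sb *.
have b0 : 0 < beta by lra.
(* Eliminating [sigma ^+ 2] in favour of [s] makes the difference a perfect square. *)
have s2E : sigma ^+ 2 = mu * (beta - mu) - mu * s ^+ 2 / beta.
  by rewrite s2; field; rewrite gt_eqF.
rewrite ler_pdivrMr; last by rewrite mulr_gt0// subr_gt0.
rewrite -subr_ge0 s2E.
have -> : mu * ((beta - s) / beta) ^+ 2 * (beta * (beta - p))
    - p * (mu * (mu - p) + (mu * (beta - mu) - mu * s ^+ 2 / beta))
  = mu * (beta - p - s) ^+ 2 by field; rewrite gt_eqF.
by rewrite mulr_ge0 ?sqr_ge0 ?ltW.
Qed.

Lemma R1_p_low_decr mu sigma1 sigma2 : 0 < mu -> 0 < sigma1 < sigma2 ->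
  R1 mu sigma2 (p_low mu sigma2) < R1 mu sigma1 (p_low mu sigma1).
Proof.
move=> mu0 /andP[s1 s12]; have s2 := lt_trans s1 s12.
have [d3 d0 d_lt] := kappa_gap mu0 s2.
(* Freeze the price that is optimal for [sigma2], lower [sigma] there, then reoptimise. *)
apply: (@lt_le_trans _ _ (R1 mu sigma1 (p_low mu sigma2))); last first.
  by apply: R1_max => //; rewrite /p_low; lra.
rewrite /R1 /p_low; set d := _ * kappa _ _ in d3 d0 d_lt *.
have s1p : 0 < sigma1 ^+ 2 by rewrite exprn_gt0.
have s12p : sigma1 ^+ 2 < sigma2 ^+ 2.
  by rewrite ltr_pXn2r ?nnegrE ?(ltW s1) ?(ltW s2).
have u0 : 0 < (mu - (mu - d)) ^+ 2 by rewrite exprn_gt0//; lra.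
rewrite ltr_pM2l; last by rewrite mulr_gt0; lra.
by rewrite ltf_pV2 ?posrE; lra.
Qed.

Lemma R3_p_high_incr mu sigma1 sigma2 beta : 0 < mu -> mu < beta ->
    0 < sigma1 < sigma2 -> sigma2 ^+ 2 < mu * (beta - mu) ->
  R3 mu sigma1 beta (p_high mu sigma1 beta)
  < R3 mu sigma2 beta (p_high mu sigma2 beta).
Proof.
move=> mu0 mub /andP[s1 s12] s2_lt; have s2 := lt_trans s1 s12.
have s12p : sigma1 ^+ 2 < sigma2 ^+ 2.
  by rewrite ltr_pXn2r ?nnegrE ?(ltW s1) ?(ltW s2).
have s1_lt := lt_trans s12p s2_lt.
have [_ t0 tb] := p_high_gap mu0 mub s1_lt.
have b0 : 0 < beta by lra.
apply: (@lt_le_trans _ _ (R3 mu sigma2 beta (p_high mu sigma1 beta))); last first.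
  by apply: R3_max => //; rewrite /p_high; lra.
rewrite /R3 /p_high; set t := Num.sqrt _ in t0 tb *.
rewrite ltr_pM2r ?invr_gt0 ?mulr_gt0//; last by lra.
by rewrite ltr_pM2l ?ltrD2l//; lra.
Qed.

End price_formulas.

(** * Lower and upper bounds on the robust revenue for a fixed [sigma] *)

Section robust_revenue.
Context {R : realType}.
Variables mu sigma beta : R.
Hypotheses (mu_gt0 : 0 < mu) (mu_lt_beta : mu < beta) (sigma_gt0 : 0 < sigma).
Local Notation revenue := (robust_revenue mu sigma beta).

Lemma robust_revenue_ge_tail p (c0 c1 c2 : R) : 0 < p ->
    (forall x, 0 <= x <= beta ->
       c0 + c1 * x + c2 * (x - mu) ^+ 2 <= ((p <= x)%R)%:R) ->
  ((p * (c0 + c1 * mu + c2 * sigma ^+ 2))%:E <= revenue p)%E.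
Proof.
move=> p0 q_le; apply: le_ereal_inf_tmp => _ [P ambP <-].
by rewrite EFinM lee_pmul2l//; exact: ambiguity_set_tail ambP q_le.
Qed.

(* Cantelli's inequality. *)
Lemma R1_le_robust_revenue p : 0 < p < mu ->
  ((R1 mu sigma p)%:E <= revenue p)%E.
Proof.
move=> /andP[p0 pmu]; set u := mu - p; have u0 : 0 < u by rewrite /u; lra.
have s2 : 0 < sigma ^+ 2 by rewrite exprn_gt0.
pose D := u ^+ 2 + sigma ^+ 2.
have D0 : 0 < D by rewrite addr_gt0 ?exprn_gt0.
have D_neq0 : D != 0 by rewrite gt_eqF.
(* The touching parabola is [1 - (y - x)^2 / (y - p)^2] with
   [y = mu + sigma^2 / (mu - p)]. *)
have -> : R1 mu sigma p
  = p * (1 - sigma ^+ 4 / D ^+ 2 - 2 * u * sigma ^+ 2 / D ^+ 2 * mu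
    + 2 * u * sigma ^+ 2 / D ^+ 2 * mu + (- (u ^+ 2 / D ^+ 2)) * sigma ^+ 2).
  by rewrite /R1 -/u /D; field.
apply: robust_revenue_ge_tail => // x _.
have -> : 1 - sigma ^+ 4 / D ^+ 2 - 2 * u * sigma ^+ 2 / D ^+ 2 * mu
    + 2 * u * sigma ^+ 2 / D ^+ 2 * x + - (u ^+ 2 / D ^+ 2) * (x - mu) ^+ 2
  = 1 - ((sigma ^+ 2 - u * (x - mu)) / D) ^+ 2 by field.
case: (leP p x) => px; first by rewrite gerBl sqr_ge0.
(* For [x < p] one has [u * (x - mu) <= - u ^+ 2], so the numerator is at least [D]. *)
rewrite subr_le0 exprn_ege1// ler_pdivlMr// mul1r /D.
have : u * (x - mu) <= u * (p - mu) by rewrite ler_pM2l//; lra.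
by rewrite /u; lra.
Qed.

Lemma R3_le_robust_revenue p : 0 < p < beta ->
  ((R3 mu sigma beta p)%:E <= revenue p)%E.
Proof.
move=> /andP[p0 pb]; have b0 : 0 < beta by lra.
have bp0 : 0 < beta - p by lra.
pose K := (beta * (beta - p))^-1.
have K0 : 0 < K by rewrite invr_gt0 mulr_gt0.
(* The touching parabola is [x (x - p) / (beta (beta - p))]. *)
have -> : R3 mu sigma beta p
  = p * (- mu ^+ 2 * K + K * (2 * mu - p) * mu + K * sigma ^+ 2).
  by rewrite /R3 -/K; ring.
apply: robust_revenue_ge_tail => // x /andP[x0 xb].
have -> : - mu ^+ 2 * K + K * (2 * mu - p) * x + K * (x - mu) ^+ 2
  = x * (x - p) * K by ring.
case: (leP p x) => px /=; last first.
  by rewrite mulr_le0_ge0 ?(ltW K0) ?mulr_ge0_le0//; lra.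
rewrite ler_pdivrMr ?mulr_gt0// mul1r ler_pM//; lra.
Qed.

Hypothesis sigma_lt : sigma ^+ 2 < mu * (beta - mu).

(** An atom at [p] itself would count as a sale; placing it at [q < p] keeps it out of the tail, at
    the cost of the factor [p / q]. *)
Lemma robust_revenue_le_below p q : 0 < q < p -> p <= beta ->
  (revenue p <= (p * (Num.max (R1 mu sigma (p_low mu sigma))
                   (R3 mu sigma beta (p_high mu sigma beta)) / q))%:E)%E.
Proof.
move=> /andP[q0 qp] pb; set M := Num.max _ _.
have b0 : 0 < beta by lra.
have s2 : 0 < sigma ^+ 2 by rewrite exprn_gt0.
have qb : 0 < beta - q by lra.
have bm : 0 < beta - mu by rewrite subr_gt0.
have mu0 := mu_gt0; have s_lt := sigma_lt.
suff [w1 [w2 [w3 [a1 [a2 [a3 [[w1_ge0 w2_ge0 w3_ge0 w_sum]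
    [a1D a2D a3D] [mean var] [a1p a2p] w3_le]]]]]]] :
  exists w1 w2 w3 a1 a2 a3 : R,
    [/\ [/\ 0 <= w1, 0 <= w2, 0 <= w3 & w1 + w2 + w3 = 1],
       [/\ 0 <= a1 <= beta, 0 <= a2 <= beta & 0 <= a3 <= beta],
       w1 * a1 + w2 * a2 + w3 * a3 = mu /\
       w1 * (a1 - mu) ^+ 2 + w2 * (a2 - mu) ^+ 2 + w3 * (a3 - mu) ^+ 2
         = sigma ^+ 2,
       a1 < p /\ a2 < p & w3 * q <= M].
  apply: (le_trans (robust_revenue_le (ltW sigma_gt0) _ w1_ge0 w2_ge0 w3_ge0
    w_sum a1D a2D a3D mean var a1p a2p)); first lra.
  by rewrite lee_fin ler_pM2l ?ler_pdivlMr//; lra.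
(* Low [q]: the Cantelli extremal law on [q] and [mu + sigma ^+ 2 / (mu - q)]. The case condition
   says exactly that the upper atom is at most [beta], and [w3 * q] is [R1] at [q]. *)
have [q_low|q_high] := leP (sigma ^+ 2) ((mu - q) * (beta - mu)).
  have u0 : 0 < mu - q by rewrite -(@pmulr_lgt0 _ (beta - mu))//; lra.
  pose D := (mu - q) ^+ 2 + sigma ^+ 2.
  have D0 : 0 < D by rewrite addr_gt0 ?exprn_gt0.
  exists 0, (sigma ^+ 2 / D), ((mu - q) ^+ 2 / D), 0, q,
    (mu + sigma ^+ 2 / (mu - q)).
  have side : ((mu - q) ^+ 2 + sigma ^+ 2 != 0) && (mu - q != 0).
    by rewrite !gt_eqF.
  have := side; rewrite andbC => side'.
  split.
  - by split; rewrite ?divr_ge0 ?sqr_ge0 ?(ltW D0)// /D; field; rewrite ?gt_eqF.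
  - split; [lra|lra|].
    rewrite addr_ge0 ?divr_ge0 ?sqr_ge0 ?(ltW u0) ?(ltW mu_gt0)//=.
    by rewrite -lerBrDl ler_pdivrMr// mulrC.
  - by split; rewrite /D; field; rewrite ?side ?side'.
  - by split; lra.
  rewrite le_max -[X in X <= R1 _ _ _](_ : R1 mu sigma q = _); last first.
    by rewrite /R1 /D; field; rewrite gt_eqF.
  by rewrite R1_max//; lra.
(* Middle [q]: atoms [0], [q], [beta], with weights forced by the moments. They are nonnegative by
   [q_high], [sigma_lt] and [q_mid] respectively, and [w3 * q] is [R3] at [q]. *)
have [q_mid|q_top] := leP (mu * q) (mu ^+ 2 + sigma ^+ 2).
  exists (((mu - q) * (mu - beta) + sigma ^+ 2) / (q * beta)),
    ((mu * (beta - mu) - sigma ^+ 2) / (q * (beta - q))),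
    ((mu * (mu - q) + sigma ^+ 2) / (beta * (beta - q))), 0, q, beta.
  split.
  - split; rewrite ?divr_ge0 ?mulr_ge0//; try lra.
    by field; rewrite !gt_eqF.
  - by split; lra.
  - by split; field; rewrite !gt_eqF.
  - by split; lra.
  rewrite le_max -[X in _ || (X <= _)](_ : R3 mu sigma beta q = _); last first.
    by rewrite /R3; ring.
  by rewrite R3_max ?orbT//; lra.
(* High [q]: the law on [0] and [mu + sigma ^+ 2 / mu] lies entirely below [q], so the tail is
   empty; the third atom is a placeholder of weight zero. *)
have e0 : 0 < mu ^+ 2 + sigma ^+ 2 by rewrite addr_gt0 ?exprn_gt0.
have a2q : mu + sigma ^+ 2 / mu < q.
  by rewrite -ltrBrDl ltr_pdivrMr//; lra.
have a2_ge0 : 0 <= sigma ^+ 2 / mu by rewrite divr_ge0 ?ltW.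
exists (sigma ^+ 2 / (mu ^+ 2 + sigma ^+ 2)), (mu ^+ 2 / (mu ^+ 2 + sigma ^+ 2)),
  0, 0, (mu + sigma ^+ 2 / mu), beta.
split.
- split; rewrite ?divr_ge0 ?(ltW e0) ?(ltW s2) ?sqr_ge0//.
  by field; rewrite gt_eqF.
- by split; lra.
- by split; field; rewrite !gt_eqF.
- by split; lra.
rewrite mul0r le_max R3_p_high//; apply/orP; right.
by apply: mulr_ge0; rewrite ?sqr_ge0 ?ltW.
Qed.

Lemma robust_revenue_le_max p : 0 < p <= beta ->
  (revenue p <= (Num.max (R1 mu sigma (p_low mu sigma))
                   (R3 mu sigma beta (p_high mu sigma beta)))%:E)%E.
Proof.
move=> /andP[p0 pb]; set M := Num.max _ _.
have M0 : 0 < M.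
  rewrite lt_max R1_p_low//; have [_ _ d_lt] := kappa_gap mu_gt0 sigma_gt0.
  by apply/orP; left; lra.
apply/lee_addgt0Pr => e e0.
have Me0 : 0 < M + e by lra.
(* The choice [q = p * (M / (M + e))] makes [p * (M / q)] equal to [M + e]. *)
have q0 : 0 < p * (M / (M + e)) by rewrite !mulr_gt0 ?invr_gt0.
have qp : p * (M / (M + e)) < p.
  by rewrite gtr_pMr// ltr_pdivrMr// mul1r ltrDl.
apply: (le_trans (@robust_revenue_le_below p (p * (M / (M + e))) _ pb)).
  by rewrite q0 qp.
rewrite -EFinD lee_fin -/M le_eqVlt; apply/orP; left; apply/eqP.
by field; rewrite !gt_eqF.
Qed.

End robust_revenue.

(** * The crossing point and the optimal prices *)

Section optimal_price.
Context {R : realType}.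
Variables mu beta : R.
Hypotheses (mu_gt0 : 0 < mu) (mu_lt_beta : mu < beta).

Lemma R1_R3_crossing : exists2 sigma, 0 < sigma < sigma_max mu beta &
  R1 mu sigma (p_low mu sigma) = R3 mu sigma beta (p_high mu sigma beta).
Proof.
have mu0 := mu_gt0; have mub := mu_lt_beta; have b0 := lt_trans mu0 mub.
have bm0 : 0 < beta - mu by rewrite subr_gt0.
(* In terms of [t = p_high / beta] the equation [R1 = R3] reads
   [mu - 3/2 d = mu t^2], which determines the gap [d = mu - p_low], and
   [p_high_gap] gives [sigma^2 = mu (beta - mu - beta (1 - t)^2)].  The cubic
   equation of [kappa_gap] thus becomes polynomial in [t]. *)
pose G : {poly R} :=
  27%:P * 'X ^+ 2 * ((beta - mu)%:P - beta%:P * (1 - 'X) ^+ 2)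
  - (4 * mu)%:P * (1 - 'X ^+ 2) ^+ 3.
have GE t : G.[t] = 27 * t ^+ 2 * (beta - mu - beta * (1 - t) ^+ 2)
    - 4 * mu * (1 - t ^+ 2) ^+ 3.
  by rewrite /G !hornerE.
(* The endpoints [t = 1 - r] and [t = 1] correspond to [sigma = 0] and
   [sigma = sigma_max mu beta]. *)
pose r := Num.sqrt ((beta - mu) / beta).
have r2 : r ^+ 2 = (beta - mu) / beta by rewrite sqr_sqrtr// divr_ge0 ?ltW.
have r0 : 0 < r by rewrite sqrtr_gt0 divr_gt0.
have r1 : r < 1.
  rewrite -(@ltr_pXn2r _ 2) ?nnegrE ?ler01 ?(ltW r0)// r2 expr1n.
  by rewrite ltr_pdivrMr// mul1r; lra.
have r2b : beta * r ^+ 2 = beta - mu by rewrite r2 mulrC divfK ?gt_eqF.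
have G_left : G.[1 - r] < 0.
  have -> : G.[1 - r] = - (4 * mu * (1 - (1 - r) ^+ 2) ^+ 3).
    by rewrite GE -r2b; ring.
  have r2_gt0 : 0 < 1 - (1 - r) ^+ 2.
    have -> : 1 - (1 - r) ^+ 2 = r * (2 - r) by ring.
    by rewrite mulr_gt0//; lra.
  by rewrite oppr_lt0 mulr_gt0 ?exprn_gt0// mulr_gt0.
have G_right : 0 < G.[1].
  have -> : G.[1] = 27 * (beta - mu) by rewrite GE; ring.
  by rewrite mulr_gt0.
have G01 : G.[1 - r] <= 0 <= G.[1] by rewrite (ltW G_left) (ltW G_right).
have r_le : 1 - r <= 1 by lra.
have [t /andP[rt t1] /rootP Gt0] := poly_ivt r_le G01.
(* The strict signs of [G] exclude both endpoints, which keeps [sigma] strictly inside its range. *)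
have {}rt : 1 - r < t.
  rewrite lt_neqAle rt andbT; apply/eqP => rt_eq.
  by rewrite rt_eq Gt0 ltxx in G_left.
have {}t1 : t < 1.
  rewrite lt_neqAle t1 andbT; apply/eqP => t1_eq.
  by rewrite -t1_eq Gt0 ltxx in G_right.
rewrite GE in Gt0.
pose v := mu * (beta - mu - beta * (1 - t) ^+ 2).
have t0 : 0 < t by lra.
have v0 : 0 < v.
  rewrite mulr_gt0// -r2b -mulrBr mulr_gt0// subr_gt0.
  by rewrite ltr_pXn2r ?nnegrE//; lra.
pose sigma := Num.sqrt v.
have s2 : sigma ^+ 2 = v by rewrite sqr_sqrtr// ltW.
have s0 : 0 < sigma by rewrite sqrtr_gt0.
have s_lt : sigma < sigma_max mu beta.
  rewrite ltr_sqrt ?mulr_gt0// ltr_pM2l// gtrBl mulr_gt0// exprn_gt0//; lra.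
have sigma_range : 0 < sigma < sigma_max mu beta by rewrite s0 s_lt.
have s2_lt := sigma_max_sqr mu0 mub sigma_range.
exists sigma => //; rewrite R1_p_low// R3_p_high//.
have -> : p_high mu sigma beta = beta * t.
  have [w2 w0 _] := p_high_gap mu0 mub s2_lt.
  rewrite /p_high; set w := Num.sqrt _ in w2 w0 *.
  suff -> : w = beta * (1 - t) by ring.
  apply/eqP; rewrite -(@eqrXn2 _ 2) ?ltW// ?mulr_gt0//; last lra.
  by apply/eqP; apply: (mulfI (lt0r_neq0 mu0)); rewrite w2 s2 /v; ring.
(* This candidate gap satisfies the cubic equation, since its residual is a multiple of [G.[t] = 0];
   uniqueness identifies it. *)
have -> : sigma * kappa mu sigma = 2 / 3 * mu * (1 - t ^+ 2).
  apply: kappa_gap_uniq => //; apply/eqP; rewrite -subr_eq0 s2 /v.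
  have -> : (2 / 3 * mu * (1 - t ^+ 2)) ^+ 3
      - mu * (beta - mu - beta * (1 - t) ^+ 2)
        * (2 * mu - 3 * (2 / 3 * mu * (1 - t ^+ 2)))
    = - (2 / 27) * mu ^+ 2
      * (27 * t ^+ 2 * (beta - mu - beta * (1 - t) ^+ 2)
         - 4 * mu * (1 - t ^+ 2) ^+ 3) by field.
  by rewrite Gt0 mulr0.
by field; rewrite gt_eqF.
Qed.

(** [robust_revenue_le_max] bounds every price by the same maximum, so optimality reduces to a lower
    bound at the one price [p]. *)
Lemma argsup_robust_revenue sigma p : 0 < sigma < sigma_max mu beta ->
    0 < p <= beta ->
    ((Num.max (R1 mu sigma (p_low mu sigma))
       (R3 mu sigma beta (p_high mu sigma beta)))%:E
      <= robust_revenue mu sigma beta p)%E ->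
  argsup `]0, beta] (robust_revenue mu sigma beta) p.
Proof.
move=> s_range p_range maxp; have /andP[s0 _] := s_range.
have s_lt := sigma_max_sqr mu_gt0 mu_lt_beta s_range.
split; first by rewrite /= in_itv.
apply/eqP; rewrite eq_le; apply/andP; split.
  by apply: ereal_sup_ubound; exists p => //=; rewrite in_itv.
apply: ge_ereal_sup => _ [q /= + <-]; rewrite in_itv => q_range.
apply: le_trans maxp; exact: robust_revenue_le_max.
Qed.

End optimal_price.

Theorem proposition4p2 (R : realType) (mu beta : R)
    (mu_gt0 : 0 < mu) (mu_lt_beta : mu < beta) :
  exists sigma_star : R,
    unique (fun s : R =>
        0 < s < sigma_max mu beta /\
        R1 mu s (p_low mu s) = R3 mu s beta (p_high mu s beta))
      sigma_star /\
    forall sigma : R, 0 < sigma < sigma_max mu beta ->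
      (sigma <= sigma_star ->
        argsup `]0, beta] (robust_revenue mu sigma beta) (p_low mu sigma)) /\
      (sigma_star <= sigma ->
        argsup `]0, beta] (robust_revenue mu sigma beta)
          (p_high mu sigma beta)).
Proof.
(* The two optimal values move strictly in opposite directions: this gives uniqueness of the
   crossing and decides which value is larger on either side of it. *)
have mono s1 s2 : 0 < s1 < s2 -> s2 < sigma_max mu beta ->
    R1 mu s2 (p_low mu s2) < R1 mu s1 (p_low mu s1) /\
    R3 mu s1 beta (p_high mu s1 beta) < R3 mu s2 beta (p_high mu s2 beta).
  move=> s12 s2_max; split; first exact: R1_p_low_decr.
  apply: R3_p_high_incr => //; apply: sigma_max_sqr => //.
  by case/andP: s12 => s1_gt0 s12; rewrite s2_max (lt_trans s1_gt0).
have [st st_range st_eq] := R1_R3_crossing mu_gt0 mu_lt_beta.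
have /andP[st_gt0 st_max] := st_range.
exists st; split.
  split=> [//|s [/andP[s_gt0 s_max] s_eq]].
  case: (ltgtP st s) => // s_st.
    have [|//|] := mono st s; first by rewrite st_gt0.
    by rewrite s_eq -st_eq => lt1 lt2; have := lt_trans lt1 lt2; rewrite ltxx.
  have [|//|] := mono s st; first by rewrite s_gt0.
  by rewrite s_eq st_eq => lt1 lt2; have := lt_trans lt1 lt2; rewrite ltxx.
move=> s s_range; have /andP[s_gt0 s_max] := s_range.
have s_lt := sigma_max_sqr mu_gt0 mu_lt_beta s_range.
have [_ d_gt0 d_lt] := kappa_gap mu_gt0 s_gt0.
have [_ w_gt0 w_lt] := p_high_gap mu_gt0 mu_lt_beta s_lt.
split=> s_st; apply: argsup_robust_revenue => //.
- by rewrite /p_low; lra.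
(* Up to [st] the [R1] value is the larger one, and Cantelli's bound at [p_low] attains it. *)
- rewrite max_l; first by apply: R1_le_robust_revenue => //; rewrite /p_low; lra.
  rewrite le_eqVlt in s_st; case/orP: s_st => [/eqP ->|s_st].
    by rewrite st_eq.
  have [|//|lt1 lt3] := mono s st; first by rewrite s_gt0.
  by rewrite (le_trans (ltW lt3))// -st_eq ltW.
- by rewrite /p_high; lra.
(* From [st] on the [R3] value is the larger one, attained by the parabola bound at [p_high]. *)
- rewrite max_r; first by apply: R3_le_robust_revenue => //; rewrite /p_high; lra.
  rewrite le_eqVlt in s_st; case/orP: s_st => [/eqP <-|s_st].
    by rewrite st_eq.
  have [|//|lt1 lt3] := mono st s; first by rewrite st_gt0.
  by rewrite (le_trans (ltW lt1))// st_eq ltW.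
Qed.
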